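(* Let $m\ge 0$ and $n\ge 0$ be integers. Then, as polynomials in $x$, $$H_{n,m+1}(x)=\sum_{T\in\mathcal{T}_{m+1}(n)}\ \prod_{v\in\mathcal{I}(T)}\frac{(mh_v+1)x+1-h_v}{(m+1)h_v}=\frac{1}{mn+1}\binom{(mn+1)x}{n},$$ where $\binom{y}{n}=y(y-1)\cdots(y-n+1)/n!$.
   Context: All trees are plane trees (rooted, children of each vertex linearly ordered, vertices unlabelled). A complete $p$-ary tree is a plane tree in which every non-leaf (internal) vertex has exactly $p$ children; $\mathcal{T}_p(n)$ denotes the set of complete $p$-ary trees with $n$ internal vertices, the unique such tree with $0$ internal vertices being a single vertex. $\mathcal{I}(T)$ is the set of internal vertices of $T$. For $v\in\mathcal{I}(T)$, the hook length $h_v$ is the number of internal vertices of the subtree of $T$ rooted at $v$ (including $v$). The empty product is $1$, so $H_{0,m+1}(x)=1$. *)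

(* Defs.v *)
From HB Require Import structures.
From mathcomp Require Import all_boot all_order all_algebra.

Set Implicit Arguments.
Unset Strict Implicit.
Unset Printing Implicit Defensive.

Import GRing.Theory.

Inductive plane_tree : Type := Node of seq plane_tree.

Definition children (T : plane_tree) : seq plane_tree := let: Node ts := T in ts.

Definition is_leaf (T : plane_tree) : bool := nilp (children T).

Lemma plane_tree_nth_ind (P : plane_tree -> Prop) :
  (forall ts, (forall i, i < size ts -> P (nth (Node [::]) ts i)) ->
     P (Node ts)) ->
  forall T, P T.
Proof.
move=> IH; fix rec 1; case=> ts; apply: IH.
elim: ts => [|t ts IHts]; first by move=> i; rewrite ltn0; discriminate.
case=> [|i]; [move=> _; exact: (rec t) | exact: IHts].
Qed.

Fixpoint plane_tree_encode (T : plane_tree) : GenTree.tree unit :=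
  let: Node ts := T in GenTree.Node 0 (map plane_tree_encode ts).

Fixpoint plane_tree_decode (g : GenTree.tree unit) : plane_tree :=
  match g with
  | GenTree.Leaf _ => Node [::]
  | GenTree.Node _ gs => Node (map plane_tree_decode gs)
  end.

Lemma plane_tree_encodeK : cancel plane_tree_encode plane_tree_decode.
Proof.
elim/plane_tree_nth_ind => ts IH /=; congr Node.
rewrite -map_comp; apply: (@eq_from_nth _ (Node [::])); rewrite size_map //.
by move=> i lti; rewrite (nth_map (Node [::])) //=; apply: IH.
Qed.

HB.instance Definition _ := Countable.copy plane_tree (can_type plane_tree_encodeK).

(* A vertex is represented by its address: the sequence of (0-based) child     *)
(* positions on the path from the root.                                        *)
Fixpoint vertices (T : plane_tree) : seq (seq nat) :=
  let: Node ts := T in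
  let vss := map vertices ts in
  [::] :: flatten [seq [seq i :: v | v <- nth [::] vss i] | i <- iota 0 (size vss)].

(* The default value is irrelevant for v \in vertices T. *)
Fixpoint subtree (T : plane_tree) (v : seq nat) : plane_tree :=
  if v is i :: v' then subtree (nth (Node [::]) (children T) i) v' else T.

Definition internal_vertices (T : plane_tree) : seq (seq nat) :=
  [seq v <- vertices T | ~~ is_leaf (subtree T v)].

Definition num_internal (T : plane_tree) : nat := size (internal_vertices T).

Definition hook_length (T : plane_tree) (v : seq nat) : nat :=
  num_internal (subtree T v).

Definition complete (p : nat) (T : plane_tree) : bool :=
  all (fun v => size (children (subtree T v)) == p) (internal_vertices T).

Record complete_tree (p n : nat) : Type := CompleteTree {
  tree_of :> plane_tree;
  _ : complete p tree_of && (num_internal tree_of == n)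
}.

HB.instance Definition _ p n := [isSub for @tree_of p n].
HB.instance Definition _ p n := [Countable of complete_tree p n by <:].

Lemma uniq_vertices T : uniq (vertices T).
Proof.
elim/plane_tree_nth_ind: T => ts IH /=; apply/andP; split.
  by apply/negP => /flatten_mapP[i _ /mapP[v]].
rewrite size_map; move: IH; set f := fun i => [seq i :: v | v <- _] => IH.
have: {in iota 0 (size ts), forall i, i < size ts} by move=> i; rewrite mem_iota.
elim: (iota _ _) (iota_uniq 0 (size ts)) => [|i s IHs] //= /andP[is_ us] H.
rewrite cat_uniq IHs // ?andbT; last first.
  by move=> j js; apply: H; rewrite inE js orbT.
have lti : i < size ts by apply: H; rewrite mem_head.
apply/andP; split.
  rewrite map_inj_uniq; last by move=> u v [].
  by rewrite (nth_map (Node [::])) //; apply: IH.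
apply/hasPn => v /flatten_mapP[j js /mapP[w _ ->]].
by apply/negP => /mapP[u _ [ji _]]; rewrite -ji js in is_.
Qed.

Lemma mem_vertices_nil T : [::] \in vertices T.
Proof. by case: T => ts; rewrite mem_head. Qed.

Lemma mem_vertices_cons ts i v :
  (i :: v \in vertices (Node ts))
    = (i < size ts) && (v \in vertices (nth (Node [::]) ts i)).
Proof.
rewrite [vertices _]/= inE /= size_map; apply/flatten_mapP/andP.
  case=> j; rewrite mem_iota add0n => /andP[_ ltj] /mapP[w wj [-> ->]].
  by split=> //; move: wj; rewrite (nth_map (Node [::])).
case=> lti vi; exists i; first by rewrite mem_iota.
by rewrite (nth_map (Node [::])) // map_f.
Qed.

Lemma mem_internal T v :
  (v \in internal_vertices T) = ~~ is_leaf (subtree T v) && (v \in vertices T).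
Proof. exact: mem_filter. Qed.

Lemma uniq_internal T : uniq (internal_vertices T).
Proof. exact: filter_uniq (uniq_vertices T). Qed.

Fixpoint seqs_over (X : Type) (g : seq X) (p : nat) : seq (seq X) :=
  if p is p'.+1 then [seq t :: ts | t <- g, ts <- seqs_over g p'] else [:: [::]].

Fixpoint trees_upto (p k : nat) : seq plane_tree :=
  Node [::] ::
  (if k is k'.+1 then map Node (seqs_over (trees_upto p k') p) else [::]).

Lemma mem_seqs_over (X : eqType) (g : seq X) p ts :
  size ts = p -> {subset ts <= g} -> ts \in seqs_over g p.
Proof.
elim: p ts => [|p IH] [|t ts] //= [sz] sub; apply/allpairsP.
exists (t, ts); split=> //=; first by apply: sub; rewrite mem_head.
by apply: IH => // u uts; apply: sub; rewrite inE uts orbT.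
Qed.

Lemma num_internal_child ts i : i < size ts ->
  num_internal (nth (Node [::]) ts i) < num_internal (Node ts).
Proof.
move=> lti; rewrite /num_internal.
have: uniq ([::] :: map (cons i) (internal_vertices (nth (Node [::]) ts i))).
  rewrite /= map_inj_uniq ?uniq_internal ?andbT; last by move=> u v [].
  by apply/negP => /mapP[].
move/(@uniq_leq_size _ _ (internal_vertices (Node ts))).
rewrite /= size_map; apply=> v; rewrite inE => /orP[/eqP->|/mapP[w + ->]].
  by rewrite mem_internal mem_vertices_nil andbT /= /is_leaf; case: ts lti.
by rewrite !mem_internal mem_vertices_cons lti.
Qed.

Lemma complete_child p ts i : i < size ts ->
  complete p (Node ts) -> complete p (nth (Node [::]) ts i).
Proof.
move=> lti /allP H; apply/allP => v vi; apply: (H (i :: v)).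
by move: vi; rewrite !mem_internal mem_vertices_cons lti.
Qed.

Lemma mem_trees_upto p k T :
  complete p T -> num_internal T <= k -> T \in trees_upto p k.
Proof.
elim: k T => [|k IH] [[|t ts]] cT nT; rewrite /= inE ?eqxx //.
apply/orP; right; apply: map_f; apply: mem_seqs_over.
  by apply/eqP; move/allP: cT => /(_ [::]) -> //; rewrite mem_internal mem_vertices_nil.
move=> u /(nthP (Node [::]))[i lti <-]; apply: IH.
  exact: complete_child cT.
exact: leq_trans (num_internal_child lti) nT.
Qed.

Definition complete_tree_enum p n : seq (complete_tree p n) :=
  pmap insub (undup (trees_upto p n)).

Lemma complete_tree_enumP p n : Finite.axiom (complete_tree_enum p n).
Proof.
apply: Finite.uniq_enumP; first exact/pmap_sub_uniq/undup_uniq.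
move=> T; rewrite mem_pmap_sub mem_undup inE; case: T => T /= H.
by case/andP: (H) => cT /eqP nT; rewrite mem_trees_upto // nT.
Qed.

HB.instance Definition _ p n := isFinite.Build (complete_tree p n)
  (@complete_tree_enumP p n).

Local Open Scope ring_scope.

Definition poly_binomial (y : {poly rat}) (n : nat) : {poly rat} :=
  (n`!%:R)^-1 *: \prod_(i < n) (y - i%:R).

(* Main.v *)
(** Decomposing a tree at its root shows that the hook sums [H_n] satisfy
    [H_0 = 1] and [H_(n+1) = w(n+1) * [z^n] H(z)^(m+1)], where [w(h)] is the
    weight of a vertex of hook length [h].  It suffices to compare both sides
    at positive integers [x].  There, with [t = m x], the right-hand side is the
    Rothe number [A_n(r) = r / (r + n t) * binom(r + n t, n)] at [r = x].
    Rothe's identity says that the convolution of [A(r)] and [A(s)] is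
    [A(r + s)], so [[z^n] H(z)^(m+1) = A_n((m+1) x)], and the recurrence reduces
    to an identity between two consecutive binomial coefficients. *)
Require Import Defs.
From mathcomp Require Import all_boot all_order all_algebra.
From mathcomp Require Import ring zify.

Set Implicit Arguments.
Unset Strict Implicit.
Unset Printing Implicit Defensive.

Import Order.TTheory GRing.Theory Num.Theory.

Local Open Scope ring_scope.

Lemma internal_vertices_Node ts :
  internal_vertices (Node ts) =
    nseq (~~ nilp ts) [::] ++
    flatten [seq [seq i :: v | v <- internal_vertices (nth (Node [::]) ts i)]
            | i <- iota 0 (size ts)].
Proof.
have E: vertices (Node ts) = [::] ::
    flatten [seq [seq i :: v | v <- vertices (nth (Node [::]) ts i)]
            | i <- iota 0 (size ts)].
  rewrite /= size_map; congr (_ :: flatten _); apply/eq_in_map => i.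
  by rewrite mem_iota add0n => /andP[_ lti]; rewrite (nth_map (Node [::])).
rewrite /internal_vertices E -cat1s filter_cat; congr (_ ++ _).
  by rewrite /= /is_leaf /=; case: nilp.
rewrite filter_flatten -map_comp; congr flatten; apply: eq_map => i /=.
by rewrite filter_map.
Qed.

Lemma num_internal_Node ts :
  num_internal (Node ts) = (~~ nilp ts + sumn (map num_internal ts))%N.
Proof.
rewrite /num_internal internal_vertices_Node size_cat size_nseq size_flatten.
congr (_ + sumn _)%N.
(* Internal vertices are grouped by child position, so [ts] is relisted by position as well. *)
rewrite /shape -map_comp -[in RHS](mkseq_nth (Node [::]) ts) /mkseq -map_comp.
by apply: eq_map => i /=; rewrite size_map.
Qed.

Lemma all_flatten (T : Type) (a : pred T) (ss : seq (seq T)) :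
  all a (flatten ss) = all (all a) ss.
Proof. by elim: ss => //= s ss IH; rewrite all_cat IH. Qed.

Lemma complete_Node p ts :
  complete p (Node ts) = (nilp ts || (size ts == p)) && all (complete p) ts.
Proof.
rewrite {1}/complete internal_vertices_Node all_cat; congr (_ && _).
  by rewrite all_nseq; case: nilp.
rewrite all_flatten all_map -[in RHS](mkseq_nth (Node [::]) ts) /mkseq all_map.
by apply: eq_all => i /=; rewrite all_map.
Qed.

Section HookSums.

Variables (R : comPzRingType) (w : nat -> R).

Definition hook_weight (T : plane_tree) : R :=
  \prod_(v <- internal_vertices T) w (hook_length T v).

Lemma hook_weight_Node ts : ~~ nilp ts ->
  hook_weight (Node ts) =
    w (num_internal (Node ts)) * \prod_(t <- ts) hook_weight t.
Proof.
move=> ts0; rewrite /hook_weight internal_vertices_Node ts0 big_cat big_seq1.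
congr (_ * _); rewrite big_flatten big_map.
rewrite -[in RHS](mkseq_nth (Node [::]) ts) /mkseq big_map.
by apply: eq_bigr => i _; rewrite big_map.
Qed.

Definition hook_sum p n : R := \sum_(T : complete_tree p n) hook_weight T.

Definition complete_trees p n : seq plane_tree :=
  map (@tree_of p n) (enum {: complete_tree p n}).

Lemma mem_complete_trees p n t :
  (t \in complete_trees p n) = complete p t && (num_internal t == n).
Proof.
apply/mapP/idP => [[T _ ->]|ct]; first exact: (valP T).
by exists (CompleteTree ct); rewrite ?mem_enum.
Qed.

Lemma uniq_complete_trees p n : uniq (complete_trees p n).
Proof. by rewrite map_inj_uniq ?enum_uniq //; exact: val_inj. Qed.

Lemma hook_sumE p n :
  hook_sum p n = \sum_(t <- complete_trees p n) hook_weight t.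
Proof. by rewrite big_map big_enum. Qed.

Definition trees_below p n : seq plane_tree :=
  flatten [seq complete_trees p i | i <- iota 0 n].

Lemma mem_trees_below p n t :
  (t \in trees_below p n) = complete p t && (num_internal t < n)%N.
Proof.
apply/flatten_mapP/andP => [[i]|[ct lt]].
  by rewrite mem_iota mem_complete_trees => lin /andP[-> /eqP ->].
by exists (num_internal t); rewrite ?mem_iota // mem_complete_trees ct eqxx.
Qed.

Lemma uniq_trees_below p n : uniq (trees_below p n).
Proof.
rewrite /trees_below; elim: (iota 0 n) (iota_uniq 0 n) => //= i s IH /andP[nis us].
rewrite cat_uniq uniq_complete_trees IH // andbT.
apply/hasPn => t /flatten_mapP[j js]; rewrite mem_complete_trees => /andP[_ /eqP nt].
by rewrite mem_complete_trees nt; apply: contraNN nis => /andP[_ /eqP <-].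
Qed.

(** Ordered forests of [q] complete trees with [n] internal vertices in total, listed by the size of
    the first tree so that sums over them unfold like [conv_pow]. *)
Fixpoint forests (p q n : nat) : seq (seq plane_tree) :=
  if q is q'.+1 then
    [seq t :: ts | t <- trees_below p n.+1,
                   ts <- forests p q' (n - num_internal t)%N]
  else if n == 0%N then [:: [::]] else [::].

Lemma mem_forests p q n ts :
  (ts \in forests p q n) =
    [&& size ts == q, all (complete p) ts & sumn (map num_internal ts) == n].
Proof.
elim: q n ts => [|q IH] n ts /=.
  by case: n; case: ts.
apply/allpairsPdep/idP => [[t [us []]]|].
  rewrite mem_trees_below ltnS IH => /andP[ct lt] /and3P[/eqP <- cus /eqP nus] ->.
  by rewrite /= ct cus nus subnKC ?eqxx.
case: ts => [|t us] //= /and3P[sz /andP[ct cus] /eqP <-].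
exists t, us; split=> //; last by rewrite IH addKn -eqSS sz cus eqxx.
by rewrite mem_trees_below ct ltnS leq_addr.
Qed.

Lemma uniq_forests p q n : uniq (forests p q n).
Proof.
elim: q n => [|q IH] n /=; first by case: eqP.
apply: allpairs_uniq_dep => [|t _|]; [exact: uniq_trees_below|exact: IH|].
by move=> [t ts] [u us] _ _ /= [-> ->].
Qed.

(** The coefficient of [z^n] in the [q]-th power of the series with coefficients [a]. *)
Fixpoint conv_pow (a : nat -> R) (q n : nat) : R :=
  if q is q'.+1 then \sum_(i < n.+1) a i * conv_pow a q' (n - i)%N
  else (n == 0%N)%:R.

(** Only coefficients of index at most [n] enter; strong induction can supply these. *)
Lemma eq_conv_pow a b q n :
  (forall i, (i <= n)%N -> a i = b i) -> conv_pow a q n = conv_pow b q n.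
Proof.
elim: q n => //= q IH n ab; apply: eq_bigr => i _.
rewrite ab -1?ltnS // (IH (n - i)%N) // => j lj.
by apply: ab; rewrite (leq_trans lj) ?leq_subr.
Qed.

Lemma sum_forests p q n :
  \sum_(ts <- forests p q n) \prod_(t <- ts) hook_weight t
    = conv_pow (hook_sum p) q n.
Proof.
elim: q n => [|q IH] n /=.
  by case: eqP => _; rewrite ?big_seq1 big_nil.
rewrite big_allpairs_dep big_flatten big_map -[iota 0 n.+1]/(index_iota 0 n.+1).
rewrite big_mkord; apply: eq_bigr => i _; rewrite hook_sumE mulr_suml.
apply: eq_big_seq => t; rewrite mem_complete_trees => /andP[_ /eqP nt].
by rewrite nt -IH mulr_sumr; apply: eq_bigr => ts _; rewrite big_cons.
Qed.

Lemma hook_sum0 p : hook_sum p 0 = 1.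
Proof.
have E: perm_eq (complete_trees p 0) [:: Node [::]].
  apply: uniq_perm; rewrite ?uniq_complete_trees // => -[ts].
  rewrite mem_complete_trees inE complete_Node num_internal_Node.
  case: ts => [|t ts]; first by rewrite eqxx.
  by rewrite andbF; apply/esym/eqP.
by rewrite hook_sumE (perm_big _ E) big_seq1 /hook_weight big_nil.
Qed.

Lemma hook_sumS p n :
  hook_sum p.+1 n.+1 = w n.+1 * conv_pow (hook_sum p.+1) p.+1 n.
Proof.
(* Removing the root is a bijection onto forests. The arity is positive, so the root is internal and
   accounts for the one extra vertex. *)
have E: perm_eq (complete_trees p.+1 n.+1) (map Node (forests p.+1 p.+1 n)).
  apply: uniq_perm; first exact: uniq_complete_trees.
    by rewrite map_inj_uniq ?uniq_forests // => x y [].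
  case=> ts; rewrite mem_map; last by move=> x y [].
  rewrite mem_complete_trees mem_forests complete_Node num_internal_Node.
  by case: ts => //= t ts; rewrite add1n !eqSS !andbA.
rewrite hook_sumE (perm_big _ E) big_map -sum_forests mulr_sumr.
apply: eq_big_seq => ts; rewrite mem_forests => /and3P[/eqP sz _ /eqP nts].
have ts0: ~~ nilp ts by rewrite /nilp sz.
by rewrite hook_weight_Node // num_internal_Node ts0 nts.
Qed.

End HookSums.

(** This is [r / (r + n t) * 'C(r + n t, n)], in a form that has no division,
    so that it is also correct when [r + n t = 0]. *)
Definition rothe (t r n : nat) : rat :=
  if n is n'.+1 then
    'C(r + n * t, n)%:R - t%:R * 'C((r + n * t).-1, n')%:R
  else 1.

(** With [K = r + n * t], absorption turns [K * 'C(K.-1, n.-1)] into [n * 'C(K, n)], and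
    [K - n * t = r]. *)
Lemma rothe_mul t r n :
  (r + n * t)%:R * rothe t r n = r%:R * 'C(r + n * t, n)%:R.
Proof.
case: n => [|n]; first by rewrite mul0n addn0 bin0.
rewrite /rothe; set K := (r + _)%N; rewrite mulrBr mulrCA.
rewrite -(natrM _ K 'C(_, n)) mul_bin_diag.
by rewrite natrM /K !natrD natrM; ring.
Qed.

Lemma rothe0 t n : rothe t 0 n = (n == 0%N)%:R.
Proof.
(* For [t = 0] the factor in [rothe_mul] vanishes and cannot be cancelled, so this case is computed
   directly. *)
case: n => // n; case: t => [|t].
  by rewrite /rothe muln0 bin0n mul0r subr0.
apply/eqP; have := rothe_mul t.+1 0 n.+1; rewrite mul0r => /eqP.
by rewrite mulf_eq0 pnatr_eq0.
Qed.

(** Pascal's rule on both binomials. For the series [B = 1 + z B^t], whose power [B^r] has these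
    coefficients, it reads [B^(r+1) = B^r + z B^(r+t)]. *)
Lemma rotheS t r n : rothe t r.+1 n.+1 = rothe t r n.+1 + rothe t (r + t) n.
Proof.
rewrite /rothe addSn /= binS.
case: n => [|n]; first by rewrite !bin0 natrD; ring.
rewrite -addnA -mulSn; set K := (r + _)%N.
(* Pascal's rule at [K.-1] needs [K > 0]; for [t = 0] the terms with [K.-1] vanish. *)
case: t @K => [|t] K; first by rewrite natrD; ring.
have K0: (0 < K)%N by rewrite /K; lia.
by rewrite -{3}(prednK K0) binS !natrD; ring.
Qed.

(* Both sides agree at [r = 0], and by [rotheS] their forward differences in
   [r] are the two sides for [n - 1] and [r + t]. *)
Lemma rothe_conv t r s n :
  \sum_(i < n.+1) rothe t r i * rothe t s (n - i)%N = rothe t (r + s) n.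
Proof.
elim: n r => [|n IHn] r; first by rewrite big_ord1 mulr1.
elim: r => [|r IHr].
  rewrite big_ord_recl rothe0 mul1r big1 ?addr0 // => i _.
  by rewrite rothe0 mul0r.
rewrite addSn rotheS -IHr addnAC -IHn big_ord_recl [in RHS]big_ord_recl -addrA.
congr (_ + _); rewrite -big_split; apply: eq_bigr => i _.
by rewrite !lift0 rotheS mulrDl subSS.
Qed.

Lemma conv_pow_rothe t r q n : conv_pow (rothe t r) q n = rothe t (q * r) n.
Proof.
elim: q n => [|q IH] n /=; first by rewrite rothe0.
by rewrite mulSn -rothe_conv; apply: eq_bigr => i _; rewrite IH.
Qed.

Definition weight_at (m x h : nat) : rat :=
  ((m + 1) * h)%:R^-1 * ((m * h + 1)%:R * x%:R + 1 - h%:R).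

(** Both Rothe numbers have the same upper index [K], and the numerator of the weight is [K - n],
    the factor linking ['C(K, n)] to ['C(K, n.+1)]. *)
Lemma rothe_weight m x n : (0 < x)%N ->
  rothe (m * x) x n.+1 = weight_at m x n.+1 * rothe (m * x) (m.+1 * x) n.
Proof.
move=> x0; rewrite /weight_at; set K := (x + n.+1 * (m * x))%N.
have E1 := rothe_mul (m * x) x n.+1; rewrite -/K in E1.
have E2 := rothe_mul (m * x) (m.+1 * x) n.
have KE: (m.+1 * x + n * (m * x))%N = K by rewrite /K; ring.
rewrite KE in E2.
have K0: K%:R != 0 :> rat by rewrite pnatr_eq0 /K; lia.
have E3: n.+1%:R * 'C(K, n.+1)%:R = (K%:R - n%:R) * 'C(K, n)%:R :> rat.
  (* Truncated subtraction differs from the rational one only for [n > K], where ['C(K, n) = 0]. *)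
  rewrite -natrM mul_bin_left natrM; case: (leqP n K) => [le|lt].
    by rewrite natrB.
  by rewrite bin_small // !mulr0.
have n0: n.+1%:R != 0 :> rat by rewrite pnatr_eq0.
have m0: m.+1%:R != 0 :> rat by rewrite pnatr_eq0.
have ->: (m * n.+1 + 1)%:R * x%:R + 1 - n.+1%:R = K%:R - n%:R :> rat.
  by rewrite /K -!natr1 !natrD !natrM -!natr1; ring.
apply: (mulfI K0); rewrite E1 mulrCA E2 addn1 !natrM.
apply: (mulfI n0); rewrite mulrCA E3; field.
by rewrite ![1 + _]addrC !natr1 n0 m0.
Qed.

Lemma hook_sum_rothe m x n : (0 < x)%N ->
  hook_sum (weight_at m x) m.+1 n = rothe (m * x) x n.
Proof.
move=> x0; elim/ltn_ind: n => -[_|n IH]; first by rewrite hook_sum0.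
rewrite hook_sumS rothe_weight // -conv_pow_rothe; congr (_ * _).
exact: eq_conv_pow.
Qed.

Lemma prod_natrB (R : pzRingType) K n :
  \prod_(i < n) (K%:R - i%:R) = (K ^_ n)%:R :> R.
Proof.
elim: n => [|n IH]; first by rewrite big_ord0.
rewrite big_ord_recr /= IH ffactnSr natrM; case: (leqP n K) => [le|lt].
  by rewrite natrB.
by rewrite ffact_small // !mul0r.
Qed.

Lemma horner_poly_binomial (y : {poly rat}) n x K : y.[x] = K%:R ->
  (poly_binomial y n).[x] = 'C(K, n)%:R.
Proof.
move=> yx; rewrite hornerZ horner_prod.
under eq_bigr do rewrite hornerD hornerN yx -polyC_natr hornerC.
rewrite prod_natrB -bin_ffact natrM mulrC mulfK // pnatr_eq0.
by rewrite -lt0n fact_gt0.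
Qed.

Lemma poly_eq_posnat (R : numDomainType) (p q : {poly R}) :
  (forall x : nat, (0 < x)%N -> p.[x%:R] = q.[x%:R]) -> p = q.
Proof.
move=> pq; apply/eqP; rewrite -subr_eq0; apply/eqP.
(* The difference has as many distinct roots [1, 2, ...] as coefficients, hence is zero. *)
apply: (@roots_geq_poly_eq0 _ _ [seq i.+1%:R | i <- iota 0 (size (p - q))]).
- by apply/allP => _ /mapP[i _ ->]; rewrite /root !hornerE pq // subrr.
- rewrite map_inj_uniq ?iota_uniq // => i j /eqP.
  by rewrite eqr_nat eqSS => /eqP.
- by rewrite size_map size_iota.
Qed.

Theorem theorem3p1 (m n : nat) :
  \sum_(T : complete_tree m.+1 n)
    \prod_(v <- internal_vertices T)
      ((((m + 1) * hook_length T v)%:R^-1 : rat) *: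
        ((m * hook_length T v + 1)%:R *: 'X + 1 - (hook_length T v)%:R))
  = (m * n + 1)%:R^-1 *: poly_binomial ((m * n + 1)%:R *: 'X) n.
Proof.
apply: poly_eq_posnat => x x0.
transitivity (hook_sum (weight_at m x) m.+1 n).
  rewrite horner_sum; apply: eq_bigr => T _; rewrite horner_prod.
  apply: eq_bigr => v _.
  by rewrite -[(hook_length T v)%:R in LHS]polyC_natr !hornerE.
have x0' : x%:R != 0 :> rat by rewrite pnatr_eq0 -lt0n.
have d0 : (m * n + 1)%:R != 0 :> rat by rewrite pnatr_eq0 addn1.
rewrite hook_sum_rothe // hornerZ (@horner_poly_binomial _ _ _ ((m * n + 1) * x)).
  have := rothe_mul (m * x) x n.
  have ->: (x + n * (m * x) = (m * n + 1) * x)%N by ring.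
  (* [E] carries the factor [x] on both sides; it cancels since [x > 0]. *)
  move=> E; apply: (mulfI d0); apply: (mulfI x0').
  by rewrite mulVKf // -E natrM; ring.
by rewrite hornerZ hornerX natrM.
Qed.
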